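(* For all integers $m,k\ge1$, every finite $(mk,k)$-grounded flag complex is $(m-1)$-connected.
   Context: Let $X$ be a simplicial complex and $k\ge1$. A simplex $\Delta$ of $X$ is a $k$-ground for $X$ if every vertex of $X$ is adjacent to all but at most $k$ vertices of $\Delta$. $X$ is $(n,k)$-grounded if it contains an $n$-simplex that is a $k$-ground for $X$. *)

(* Defs.v *)
From HB Require Import structures.
From mathcomp Require Import all_boot all_order all_algebra.
From mathcomp Require Import all_classical all_reals all_analysis.
From mathcomp Require Import Rstruct Rstruct_topology.
From Stdlib Require Import Rdefinitions.

Set Implicit Arguments.
Unset Strict Implicit.
Unset Printing Implicit Defensive.

Import Order.TTheory GRing.Theory Num.Theory.
Import numFieldNormedType.Exports.
Local Open Scope ring_scope.

Definition simplicial_complex (n : nat) (F : {set {set 'I_n}}) : Prop :=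
  [/\ finset.set0 \notin F,
      (forall v : 'I_n, [set v] \in F) &
      (forall s t : {set 'I_n}, s \in F -> t \subset s -> t != finset.set0 -> t \in F)].

Definition adjacent (n : nat) (F : {set {set 'I_n}}) (u v : 'I_n) : bool :=
  (u != v) && ([set u; v] \in F).

Definition flag_complex (n : nat) (F : {set {set 'I_n}}) : Prop :=
  forall s : {set 'I_n}, s != finset.set0 ->
    (forall u v, u \in s -> v \in s -> u != v -> adjacent F u v) -> s \in F.

Definition k_ground (n : nat) (F : {set {set 'I_n}}) (k : nat) (D : {set 'I_n}) : Prop :=
  D \in F /\ forall x : 'I_n, leq #|[set y in D | ~~ adjacent F x y]| k.

Definition grounded (n : nat) (F : {set {set 'I_n}}) (p k : nat) : Prop :=
  exists D : {set 'I_n}, #|D| = p.+1 /\ k_ground F k D.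

Definition realization (n : nat) (F : {set {set 'I_n}}) : set 'rV[R]_n :=
  (fun t => (forall i, 0 <= t ord0 i) /\ \sum_i t ord0 i = 1 /\
           [set i | t ord0 i != 0] \in F).

(* Unit ball and unit sphere of R^d (for the sup norm of 'rV; the pair
   (ball, sphere) is homeomorphic to the Euclidean (D^d, S^(d-1))).
   For d = 0 the ball is a point and the sphere is empty. *)
Definition unit_ball (d : nat) : set 'rV[R]_d := (fun x => `|x| <= 1).
Definition unit_sphere (d : nat) : set 'rV[R]_d := (fun x => `|x| = 1).
Arguments unit_ball d : clear implicits.
Arguments unit_sphere d : clear implicits.

(* A subspace A of R^n is c-connected (c >= -1 an integer) when for every
   i with -1 <= i <= c, every continuous map S^i -> A extends to a
   continuous map D^(i+1) -> A (here d = i+1).  For i = -1 this says A is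
   nonempty. *)
Definition c_connected (n : nat) (c : int) (A : set 'rV[R]_n) : Prop :=
  forall d : nat, (Posz d <= c + 1) ->
    forall f : 'rV[R]_d -> 'rV[R]_n,
      {within unit_sphere d, continuous f}%classic -> (forall x, unit_sphere d x -> A (f x)) ->
      exists g : 'rV[R]_d -> 'rV[R]_n,
        [/\ {within unit_ball d, continuous g}%classic, (forall x, unit_ball d x -> A (g x)) &
            forall x, unit_sphere d x -> g x = f x].

(* Main.v *)
Require Import Defs.
From HB Require Import structures.
From mathcomp Require Import all_boot all_order all_algebra.
From mathcomp Require Import all_classical all_reals all_analysis.
From mathcomp Require Import Rstruct Rstruct_topology.
From mathcomp Require Import lra.
(* MathComp-Analysis also has an [adjacent]. *)
Import Defs.

(* Let D be the ground simplex, with mk+1 vertices, and let f be a map from the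
   boundary of a d-cube to the complex, d <= m. A partition of unity of order d
   on the boundary, coming from Kuhn's triangulation of a fine grid, deforms f
   inside the faces carrying it to a map g taking values in faces with at most m
   vertices. Any such face s has a common neighbour in D, since its vertices
   exclude at most mk vertices of D. A vertex of D adjacent to all of s need not
   depend continuously on the point, so thresholds are used: with eps = 1/(n+1),
   cut(x) keeps only the coordinates of g(x) above eps, and cone(x) gives to
   y in D the weight by which eps exceeds the total mass of g(x) on vertices not
   adjacent to y. Every vertex in the support of cut(x) is then adjacent to every
   vertex in the support of cone(x), so, the complex being flag, the straight-line
   homotopies g ~ cut ~ cone ~ (a vertex of D) stay in the complex. *)

Set Implicit Arguments.
Unset Strict Implicit.
Unset Printing Implicit Defensive.
Import Order.TTheory GRing.Theory Num.Theory.
Import numFieldNormedType.Exports.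
Local Open Scope ring_scope.

(** * Vertex weights for Kuhn's triangulation *)

Section KuhnWeights.
Variables (R : realType) (d : nat).
Implicit Types (a : 'I_d -> R) (z : 'I_d -> nat).

Definition offset a z (q : option 'I_d) : R := oapp (fun i => (z i)%:R - a i) 0 q.

(* Nonzero exactly when some t in (0, 1) satisfies z i < a i + t < z i + 1 for all i,
   i.e. when [a] lies in the open star of the vertex [z] of Kuhn's triangulation:
   the existence of t amounts to pairwise inequalities, and [None], of offset 0,
   accounts for the bounds 0 and 1 on t. *)
Definition kuhn_weight a z : R :=
  \prod_(p : option 'I_d * option 'I_d)
    Num.max 0 (1 + offset a z p.1 - offset a z p.2).

Lemma kuhn_weight_ge0 a z : 0 <= kuhn_weight a z.
Proof. by apply: prodr_ge0 => p _; rewrite le_max lexx. Qed.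

Lemma kuhn_weight_gt0P a z :
  reflect (forall p q, offset a z q < 1 + offset a z p) (0 < kuhn_weight a z).
Proof.
apply: (iffP idP) => [w_gt0 p q | lt_off].
  have := lt0r_neq0 w_gt0; rewrite prodf_seq_neq0 => /allP /(_ (p, q)).
  rewrite mem_index_enum => /(_ isT) /=.
  by case: (leP (1 + offset a z p - offset a z q) 0) => [|]; rewrite ?eqxx // subr_gt0.
by apply: prodr_gt0 => p _; rewrite lt_max subr_gt0 lt_off orbT.
Qed.

Lemma kuhn_weight_near a z i : 0 < kuhn_weight a z -> `|(z i)%:R - a i| < 1.
Proof.
move=> /kuhn_weight_gt0P lt_off.
have := lt_off None (Some i); have := lt_off (Some i) None; rewrite /offset /=.
by rewrite ltr_norml; lra.
Qed.

(** All offsets of the integer part lie in [(-1, 0]], so any two differ by less than 1. *)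
Lemma kuhn_weight_trunc a :
  (forall i, 0 <= a i) -> 0 < kuhn_weight a (fun i => Num.truncn (a i)).
Proof.
move=> a_ge0; apply/kuhn_weight_gt0P.
have off_bnd q : -1 < offset a (fun i => Num.truncn (a i)) q <= 0.
  case: q => [i|] /=; last lra.
  by have /andP[] := truncn_itv (a_ge0 i); rewrite -natr1; lra.
by move=> p q; have := off_bnd p; have := off_bnd q; lra.
Qed.

(** Adding the offset inequalities of [z] and [z'] gives [(z' i - z i) + (z j - z' j) < 2], so these
    integers are not both positive. Vertices whose stars share a point thus form a chain. *)
Lemma kuhn_weight_chain a z z' i j :
  0 < kuhn_weight a z -> 0 < kuhn_weight a z' ->
  (z i < z' i)%N -> (z j <= z' j)%N.
Proof.
move=> /kuhn_weight_gt0P/(_ (Some i) (Some j)) /= off.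
move=> /kuhn_weight_gt0P/(_ (Some j) (Some i)) /= off' lt_i.
rewrite leqNgt; apply/negP => lt_j.
by move: lt_i lt_j off off'; rewrite -!(ler_nat R) -!natr1; lra.
Qed.

(** The two vertices are comparable coordinatewise, and comparable vectors with equal sums
    coincide. *)
Lemma kuhn_weight_sum_inj a z z' :
  0 < kuhn_weight a z -> 0 < kuhn_weight a z' ->
  (\sum_i z i = \sum_i z' i)%N -> z =1 z'.
Proof.
have half y y' : 0 < kuhn_weight a y -> 0 < kuhn_weight a y' ->
    (\sum_i y i = \sum_i y' i)%N -> forall i, (y' i <= y i)%N.
  move=> wy wy' eq_sum i; rewrite leqNgt; apply/negP => lt_i.
  suff : (\sum_i y i < \sum_i y' i)%N by rewrite eq_sum ltnn.
  rewrite (bigD1 i) //= [ltnRHS](bigD1 i) //= -addSn leq_add //.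
  by apply: leq_sum => j _; exact: (kuhn_weight_chain j wy wy' lt_i).
move=> wz wz' eq_sum i; apply/eqP; rewrite eqn_leq.
by rewrite (half z z') // (half z' z).
Qed.

(* The coordinate [a j] being an integer, [z j] takes a single value, so that
   the sum of the coordinates of [z] takes at most [d] values. *)
Lemma card_kuhn_weight_gt0 a (M : nat) (Z : {set {ffun 'I_d -> 'I_M}}) j (c : nat) :
  (forall i, 0 <= a i) -> a j = c%:R ->
  (forall z : {ffun 'I_d -> 'I_M}, z \in Z -> 0 < kuhn_weight a (fun i => z i)) ->
  (#|Z| <= d)%N.
Proof.
move=> a_ge0 aj wZ; pose t i := Num.truncn (a i).
have t_le (z : {ffun 'I_d -> 'I_M}) i : z \in Z -> (t i <= z i <= t i + (i != j))%N.
  move=> /wZ wz; have := kuhn_weight_near i wz; have /andP[] := truncn_itv (a_ge0 i).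
  rewrite -/(t i) ltr_norml => le_t lt_t /andP[lt1 lt2].
  have -> : (t i <= z i)%N by rewrite -ltnS -(ltr_nat R) -natr1; lra.
  have [eq_ij|_] /= := eqVneq i j.
    have -> : t i = c by rewrite /t eq_ij aj natrK.
    move: lt1 lt2; rewrite eq_ij aj addn0 => lt1 lt2.
    by rewrite -ltnS -(ltr_nat R) -natr1; lra.
  by rewrite -ltnS addn1 -(ltr_nat R) -[(t i).+2%:R]natr1; lra.
(* On [Z] the [j]-th term vanishes and the others are at most 1, so the sum is below [d] and the
   default [j] does not interfere. *)
pose h (z : {ffun 'I_d -> 'I_M}) := insubd j (\sum_i (z i - t i))%N.
have hE (z : {ffun 'I_d -> 'I_M}) : z \in Z -> (h z : nat) = (\sum_i (z i - t i))%N.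
  move=> zZ; rewrite val_insubd ifT //.
  apply: (@leq_ltn_trans (\sum_(i < d) (i != j))).
    by apply: leq_sum => i _; have := t_le z i zZ; rewrite leq_subLR => /andP[].
  apply: (@leq_trans (\sum_(i < d) 1)); last by rewrite sum1_card card_ord.
  rewrite (bigD1 j) //= eqxx add0n [ltnRHS](bigD1 j) //= ltnS.
  by apply: leq_sum => i _; case: (i != j).
have sumE (z : {ffun 'I_d -> 'I_M}) : z \in Z -> (\sum_i z i = h z + \sum_i t i)%N.
  move=> zZ; rewrite hE // -big_split /=; apply: eq_bigr => i _.
  by rewrite subnK //; case/andP: (t_le z i zZ).
rewrite -(card_in_imset (f := h)) => [|z z' zZ z'Z eq_h].
  by rewrite (leq_trans (max_card _)) ?card_ord.
apply/ffunP => i; apply: val_inj.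
by apply: (kuhn_weight_sum_inj (wZ z zZ) (wZ z' z'Z)); rewrite !sumE // eq_h.
Qed.
End KuhnWeights.

(** * Relative continuity and the sup norm *)

Section Within.
Local Open Scope classical_set_scope.

Lemma within_cvgP {T U : topologicalType} (A : set T) (f : T -> U) :
  {within A, continuous f} <-> forall x, A x -> f @ within A (nbhs x) --> f x.
Proof. exact: (@subspace_continuousP T A U f). Qed.

Context {T U V : topologicalType}.

Lemma within_comp (A : set T) (B : set U) (u : T -> U) (f : U -> V) :
  {within A, continuous u} -> {within B, continuous f} ->
  (forall x, A x -> B (u x)) -> {within A, continuous (f \o u)}.
Proof.
move=> /within_cvgP cu /within_cvgP cf AB; apply/within_cvgP => x Ax.
apply: (@cvg_comp _ _ _ u f _ (within B (nbhs (u x)))); last exact/cf/AB.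
move=> W nW; have nAW := cu x Ax _ nW.
have FA : Filter (within A (nbhs x)) by exact: within_filter.
rewrite /= nbhs_simpl /=; near=> y.
have Ay : A y by near: y; exact: withinT.
by have := AB _ Ay; near: y.
Unshelve. all: by end_near. Qed.

Lemma within_ext (A : set T) (f g : T -> U) :
  (forall x, A x -> f x = g x) -> {within A, continuous f} ->
  {within A, continuous g}.
Proof.
by move=> fg; apply: subspace_eq_continuous => x; rewrite inE => /fg.
Qed.
End Within.

Section RowVectors.
Variables (R : realType) (n : nat).
Local Open Scope classical_set_scope.

Lemma cvg_rV (T : Type) (G : set_system T) (g : T -> 'rV[R]_n) (l : 'rV[R]_n) :
  Filter G -> (forall j, g x ord0 j @[x --> G] --> l ord0 j) -> g @ G --> l.
Proof.
move=> FG cg; apply/cvgrPdist_lt => e e_gt0.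
have : \forall x \near G, forall j, `|l ord0 j - g x ord0 j| < e.
  by apply: filter_forall => j; move/cvgrPdist_lt : (cg j); apply.
apply: filterS => x lt_e; rewrite [ltLHS]/Num.norm /= mx_normrE.
by apply/bigmax_ltP; split => // -[i j] _ /=; rewrite !mxE ord1.
Qed.

Lemma closed_norm_preimage (A : set R) :
  closed A -> closed [set x : 'rV[R]_n | A `|x|].
Proof.
move=> cA; have /continuous_closedP := @norm_continuous R 'rV[R]_n.
exact.
Qed.

Lemma compact_sphere : compact [set x : 'rV[R]_n | `|x| = 1].
Proof.
apply: bounded_closed_compact; first by exists 1; split=> // M M1 x /= ->; exact: ltW.
exact: (closed_norm_preimage (@closed_eq R 1)).
Qed.
End RowVectors.

Section Lebesgue.
Variables (R : realType) (d n : nat) (K : set 'rV[R]_d) (f : 'rV[R]_d -> 'rV[R]_n).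
Local Open Scope classical_set_scope.

(** [e] is a Lebesgue number for the cover of [K] by the relatively open sets where a given
    coordinate of [f] is positive. *)
Lemma uniform_positive_coordinate : compact K -> {within K, continuous f} ->
  (forall x, K x -> exists i, 0 < f x ord0 i) ->
  exists2 e, 0 < e & forall x, K x -> exists i,
    forall y, K y -> `|x - y| < e -> 0 < f y ord0 i.
Proof.
move=> /compact_near_coveringP cK /within_cvgP cf f_pos.
pose P (e : R) x := exists i, forall y, K y -> `|x - y| < e -> 0 < f y ord0 i.
have : \forall e \near 0^'+, K `<=` P e.
  apply: cK => x Kx; have [i fi_gt0] := f_pos x Kx.
  have : \forall y \near within K (nbhs x), 0 < f y ord0 i.
    have cfi : f y ord0 i @[y --> within K (nbhs x)] --> f x ord0 i.
      by apply: (@cvg_comp _ _ _ f (fun v : 'rV[R]_n => v ord0 i) _ (nbhs (f x)));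
        [exact: cf|exact: coord_continuous].
    exact: (cvgr_gt _ cfi).
  rewrite near_withinE => /nbhs_normP [r /= r_gt0 ball_r].
  (* Half of [r] is for moving the centre to [x'], half for the radius [e]. *)
  have near_x : \forall z \near x, `|x - z| < r / 2.
    by apply/nbhs_normP; exists (r / 2) => //=; exact: divr_gt0.
  near=> x' e; exists i => y Ky lt_e; apply: ball_r => //=.
  have -> : x - y = (x - x') + (x' - y) by rewrite addrA subrK.
  rewrite (le_lt_trans (ler_normD _ _)) // [r]splitr ltrD //.
    by near: x'; exact: near_x.
  apply: lt_trans lt_e _ => /=; near: e; apply: nbhs_right_lt; exact: divr_gt0.
move=> nearP.
have [e [e_gt0 Pe]] : exists e : R, 0 < e /\ K `<=` P e.
  near (0 : R)^'+ => e; exists e; split; first by near: e; exact: nbhs_right_gt.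
  by near: e.
by exists e.
Unshelve. all: by end_near. Qed.
End Lebesgue.

(** * Closed faces in barycentric coordinates *)

Section Faces.
Variables (R : realType) (n : nat).
Implicit Types (F : {set {set 'I_n}}) (s : {set 'I_n}) (t : 'rV[R]_n).

Definition in_face s t : Prop :=
  [/\ forall i, 0 <= t ord0 i, \sum_i t ord0 i = 1 &
      forall i, t ord0 i != 0 -> i \in s].

Lemma in_face_pos s t : in_face s t -> exists2 i, i \in s & 0 < t ord0 i.
Proof.
move=> [t_ge0 t_sum t_s]; have : \sum_i t ord0 i != 0 by rewrite t_sum oner_neq0.
rewrite psumr_neq0 => [/hasP[i _ /= ti_gt0]|i _]; last exact: t_ge0.
by exists i => //; apply: t_s; rewrite gt_eqF.
Qed.

Lemma in_faceS s s' t : s \subset s' -> in_face s t -> in_face s' t.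
Proof. by move=> /fintype.subsetP ss' [t0 t1 ts]; split=> // i /ts/ss'. Qed.

Lemma in_face_conv s t t' (l : R) :
  0 <= l <= 1 -> in_face s t -> in_face s t' ->
  in_face s (l *: t + (1 - l) *: t').
Proof.
move=> /andP[l_ge0 l_le1] [t_ge0 t_sum t_s] [t'_ge0 t'_sum t'_s]; split.
- by move=> i; rewrite !mxE addr_ge0 ?mulr_ge0 ?subr_ge0.
- under eq_bigr do rewrite !mxE.
  by rewrite big_split /= -!mulr_sumr t_sum t'_sum !mulr1 addrC subrK.
- move=> i; rewrite !mxE; have [->|/t_s//] := eqVneq (t ord0 i) 0.
  by have [->|/t'_s//] := eqVneq (t' ord0 i) 0; rewrite !mulr0 addr0 eqxx.
Qed.

Definition normalize t : 'rV[R]_n := (\sum_i t ord0 i)^-1 *: t.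

Lemma sum_pos t i : (forall j, 0 <= t ord0 j) -> 0 < t ord0 i ->
  0 < \sum_j t ord0 j.
Proof.
move=> t_ge0 ti; rewrite (bigD1 i) //= ltr_pwDl //.
by apply: sumr_ge0 => j _; exact: t_ge0.
Qed.

Lemma in_face_normalize s t i :
  (forall j, 0 <= t ord0 j) -> 0 < t ord0 i ->
  (forall j, 0 < t ord0 j -> j \in s) -> in_face s (normalize t).
Proof.
move=> t_ge0 ti t_s; have sum_gt0 := sum_pos t_ge0 ti; split.
- by move=> j; rewrite mxE mulr_ge0 // invr_ge0 ltW.
- by under eq_bigr do rewrite mxE; rewrite -mulr_sumr mulVf // gt_eqF.
- move=> j; rewrite mxE mulf_eq0 negb_or => /andP[_ tj].
  by apply: t_s; rewrite lt_neqAle eq_sym tj t_ge0.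
Qed.
End Faces.

(** * Extension to the ball along a straight-line homotopy *)

Section Extension.
Variables (R : realType) (n d : nat) (A : set 'rV[R]_n).
Local Open Scope classical_set_scope.

Let sphere := [set x : 'rV[R]_d | `|x| = 1].
Let ball1 := [set x : 'rV[R]_d | `|x| <= 1].

Definition extends_to_ball (f : 'rV[R]_d -> 'rV[R]_n) : Prop :=
  exists g : 'rV[R]_d -> 'rV[R]_n,
    [/\ {within ball1, continuous g},
        (forall x, ball1 x -> A (g x)) &
        forall x, sphere x -> g x = f x].

(** The extension of [g] is shrunk to the ball of radius 1/2, and the homotopy fills the collar
    around it. *)
Lemma extends_homotopic (f g : 'rV[R]_d -> 'rV[R]_n) :
  {within sphere, continuous f} ->
  (forall x l, sphere x -> 0 <= l <= 1 -> A (l *: f x + (1 - l) *: g x)) ->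
  extends_to_ball g -> extends_to_ball f.
Proof.
move=> cf fg [G [cG G_A Gg]].
pose in_ball := [set x : 'rV[R]_d | `|x| <= 2^-1].
pose annulus := [set x : 'rV[R]_d | 2^-1 <= `|x| <= 1].
pose dir (x : 'rV[R]_d) := `|x|^-1 *: x.
(* The coefficient of [f] runs from 0 at radius 1/2 to 1 at radius 1. *)
pose k x := (2 * `|x| - 1) *: f (dir x) + (1 - (2 * `|x| - 1)) *: G (dir x).
pose h x := if `|x| <= 2^-1 then G (2 *: x) else k x.
have dirS x : annulus x -> sphere (dir x).
  move=> /andP[x_ge _]; rewrite /sphere /= normrZ normfV normr_id mulVf //.
  by rewrite gt_eqF // (lt_le_trans _ x_ge).
have sphere_ball x : sphere x -> ball1 x by rewrite /ball1 /= => ->.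
have normc x : `|y| @[y --> within annulus (nbhs x)] --> (`|x| : R).
  by apply: cvg_trans (@norm_continuous _ _ x); apply: cvg_fmap2; exact: cvg_within.
have cdir : {within annulus, continuous dir}.
  apply/within_cvgP => x /andP[x_ge _]; apply: cvgZ; last exact: cvg_within.
  by apply: cvgV; [rewrite gt_eqF // (lt_le_trans _ x_ge)|exact: normc].
have ck : {within annulus, continuous k}.
  have /within_cvgP cfd : {within annulus, continuous (f \o dir)}.
    exact: within_comp cdir cf dirS.
  have /within_cvgP cGd : {within annulus, continuous (G \o dir)}.
    by apply: within_comp cdir cG _ => x /dirS/sphere_ball.
  apply/within_cvgP => x Ax.
  have cl : 2 * `|y| - 1 @[y --> within annulus (nbhs x)] --> 2 * `|x| - 1.
    by apply: cvgB; [apply: cvgM; [exact: cvg_cst|exact: normc]|exact: cvg_cst].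
  apply: cvgD; apply: cvgZ => //; [exact: cfd| |exact: cGd].
  by apply: cvgB => //; exact: cvg_cst.
have cG2 : {within in_ball, continuous (fun x => G (2 *: x))}.
  have c2 : {within in_ball, continuous (fun x : 'rV[R]_d => 2 *: x)}.
    by apply: continuous_subspaceT; exact: scaler_continuous.
  apply: within_comp c2 cG _ => x.
  rewrite /in_ball /ball1 /= /= normrZ ger0_norm //; lra.
exists h; split.
- have -> : ball1 = in_ball `|` annulus.
    apply/seteqP; split => x; rewrite /ball1 /= /in_ball /annulus /=.
      by move=> x1; case: (leP `|x| 2^-1) => [|/ltW]; [left|right; apply/andP].
    by case=> [|/andP[]//]; lra.
  apply: withinU_continuous.
  + exact: (closed_norm_preimage (@closed_le R _)).
  + rewrite (_ : annulus =
        [set x | [set r | 2^-1 <= r] `|x|] `&` [set x | [set r | r <= 1] `|x|]).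
      by apply: closedI; apply: closed_norm_preimage;
        [exact: closed_ge|exact: closed_le].
    by apply/seteqP; split => x /=; [move/andP|move=> ?; exact/andP].
  + by apply: within_ext cG2 => x; rewrite /in_ball /= /h => ->.
  + apply: within_ext ck => x Ax; rewrite /h; case: ifP => // x_le.
    (* The closed pieces meet at radius 1/2, where [dir x] is [2 *: x] and [f] has coefficient 0, so
       both formulas agree. *)
    have x_eq : `|x| = 2^-1 by apply/eqP; rewrite eq_le x_le; case/andP: Ax.
    by rewrite /k /dir x_eq invrK mulfV // subrr scale0r add0r subr0 scale1r.
- move=> x x1; rewrite /h; case: leP => x_half.
    by apply: G_A; rewrite /ball1 /= normrZ ger0_norm //; move: x_half; lra.
  have Sx : sphere (dir x) by apply: dirS; rewrite /annulus /= x1 ltW.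
  rewrite /k Gg //; apply: fg => //.
  by move: x1 x_half; rewrite /ball1 /=; lra.
- move=> x x1; rewrite /h /k /dir x1 ifF; last by apply/negbTE; rewrite -ltNge; lra.
  by rewrite invr1 scale1r (_ : 2 * 1 - 1 = 1 :> R) ?subrr ?scale1r ?scale0r ?addr0 //; lra.
Qed.
End Extension.

(** * Homotopies within faces, and common neighbours *)

Section Geometry.
Variables (R : realType) (n : nat) (F : {set {set 'I_n}}).
Local Open Scope classical_set_scope.

(** The realization as a union of closed faces: with no exact support to track, segments inside a
    face are easy to handle. *)
Definition geom : set 'rV[R]_n := [set t | exists2 s, s \in F & in_face s t].

Lemma extends_common_face d (f g : 'rV[R]_d -> 'rV[R]_n) :
  {within [set x | `|x| = 1], continuous f} ->
  (forall x, `|x| = 1 -> exists s, [/\ s \in F, in_face s (f x) & in_face s (g x)]) ->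
  extends_to_ball geom g -> extends_to_ball geom f.
Proof.
move=> cf fg; apply: extends_homotopic => // x l /fg[s [sF f_s g_s]] l01.
by exists s => //; exact: in_face_conv.
Qed.

Lemma within_normalize (T : topologicalType) (A : set T) (f : T -> 'rV[R]_n) :
  (forall i, {within A, continuous (fun x => f x ord0 i)}) ->
  (forall x, A x -> \sum_i f x ord0 i != 0) ->
  {within A, continuous (fun x => normalize (f x))}.
Proof.
move=> cf f_neq0; apply/within_cvgP => x Ax.
have cfx i : f y ord0 i @[y --> within A (nbhs x)] --> f x ord0 i.
  by have /within_cvgP := cf i; exact.
apply: cvgZ; last exact: cvg_rV.
apply: cvgV; first exact: f_neq0.
by apply: (cvg_big add_continuous) => i _; exact: cfx.
Qed.

Lemma adjacentC (u v : 'I_n) : adjacent F u v = adjacent F v u.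
Proof. by rewrite /adjacent eq_sym finset.setUC. Qed.

Lemma face_adjacent (s : {set 'I_n}) u v :
  simplicial_complex F -> s \in F -> u \in s -> v \in s -> u != v -> adjacent F u v.
Proof.
move=> [_ _ F_down] sF us vs uv; rewrite /adjacent uv /=.
apply: (F_down s) => //; first by rewrite finset.subUset !finset.sub1set us vs.
by apply/finset.set0Pn; exists u; rewrite !inE eqxx.
Qed.

(** Each vertex of [s] excludes at most [k] vertices of [D]; together they exclude at most
    [m * k]. *)
Lemma common_neighbour m k (D s : {set 'I_n}) :
  k_ground F k D -> (m * k < #|D|)%N -> (#|s| <= m)%N ->
  exists2 y, y \in D & forall v, v \in s -> adjacent F v y.
Proof.
move=> [_ D_ground] ltD les.
suff /fintype.subsetPn[y yD] : ~~ (D \subset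
    (\bigcup_(v in s) [set y in D | ~~ adjacent F v y])%SET).
  move=> y_nbad; exists y => // v vs; apply: contraNT y_nbad => nadj.
  by apply/bigcupP; exists v => //; rewrite inE yD.
apply/negP => /subset_leq_card; rewrite leqNgt => /negP; apply.
apply: leq_ltn_trans ltD.
apply: (@leq_trans (\sum_(v in s) #|[set y in D | ~~ adjacent F v y]|)).
  apply: (big_ind2 (fun (A : {set 'I_n}) c => #|A| <= c)%N) => //.
    by rewrite cards0.
  move=> A a B b Aa Bb; rewrite (leq_trans _ (leq_add Aa Bb)) //.
  by rewrite cardsU leq_subr.
apply: (@leq_trans (\sum_(v in s) k)); first by apply: leq_sum => v _.
by rewrite sum_nat_const leq_mul2r les orbT.
Qed.
End Geometry.

(** * Contracting maps with values in small faces *)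

Lemma cvg_max0 (R : realType) (T : Type) (G : set_system T) (f : T -> R) (a : R) :
  Filter G -> (f @ G --> a -> Num.max 0 (f x) @[x --> G] --> Num.max 0 a)%classic.
Proof.
move=> FG fa; apply: (cvg_comp _ _ fa).
exact: (@continuous_max R R (cst 0) id a (cvg_cst _) cvg_id).
Qed.

Lemma skeletal_extends (R : realType) n d m k (F : {set {set 'I_n}})
    (D : {set 'I_n}) (g : 'rV[R]_d -> 'rV[R]_n) :
  simplicial_complex F -> flag_complex F -> k_ground F k D -> (m * k < #|D|)%N ->
  {within [set x | `|x| = 1], continuous g}%classic ->
  (forall x, `|x| = 1 -> exists s, [/\ s \in F, (#|s| <= m)%N & in_face s (g x)]) ->
  extends_to_ball (geom F) g.
Proof.
move=> scF flagF groundD ltD cg g_skel; have [D_F _] := groundD.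
have [p pD] : exists p, p \in D by apply/card_gt0P; exact: leq_ltn_trans ltD.
(* With [n] coordinates of sum 1, some coordinate must exceed [1/(n+1)], so [cut x] will not
   vanish. *)
pose eps : R := n.+1%:R^-1; have eps_gt0 : 0 < eps by rewrite invr_gt0 ltr0n.
pose cut x : 'rV[R]_n := \row_i Num.max 0 (g x ord0 i - eps).
(* Adjacency is irreflexive, so the mass of [g x] at [y] itself counts as bad. *)
pose bad x y := \sum_(v | ~~ adjacent F v y) g x ord0 v.
pose cone x : 'rV[R]_n :=
  \row_y if y \in D then Num.max 0 (eps - bad x y) else 0.
have cgx x i : `|x| = 1 -> (g y ord0 i @[y --> within [set x | `|x| = 1]
    (nbhs x)] --> g x ord0 i)%classic.
  move=> x1; move/within_cvgP: cg => /(_ x x1) cgx.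
  exact: (cvg_comp _ _ cgx (@coord_continuous _ _ _ ord0 i _)).
have cut_ge0 x j : 0 <= cut x ord0 j by rewrite mxE le_max lexx.
have cone_ge0 x j : 0 <= cone x ord0 j.
  by rewrite mxE; case: ifP => // _; rewrite le_max lexx.
have cut_pos x i : (0 < cut x ord0 i) = (eps < g x ord0 i).
  by rewrite mxE lt_max ltxx subr_gt0.
have cone_pos x y : (0 < cone x ord0 y) = (y \in D) && (bad x y < eps).
  by rewrite mxE; case: ifP => _ //=; rewrite ?lt_max ltxx ?subr_gt0.
have cut_ex x s : in_face s (g x) -> exists i, 0 < cut x ord0 i.
  move=> [_ g1 _]; apply/existsP; rewrite -[X in is_true X]negbK negb_exists.
  apply/negP => /forallP all_le; have : \sum_i g x ord0 i <= \sum_(i < n) eps.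
    by apply: ler_sum => i _; have := all_le i; rewrite cut_pos -leNgt.
  rewrite g1 sumr_const card_ord /eps -[_ *+ n]mulr_natl leNgt => /negP; apply.
  by rewrite ltr_pdivrMr ?ltr0n // mul1r ltr_nat.
have cone_ex x s : s \in F -> (#|s| <= m)%N -> in_face s (g x) ->
    exists y, 0 < cone x ord0 y.
  (* At a common neighbour of [s] the bad mass is 0. *)
  move=> sF les [_ _ g_s]; have [y yD adj_y] := common_neighbour groundD ltD les.
  exists y; rewrite cone_pos yD /= /bad big1 // => v nadj.
  by apply/eqP; apply: contraNT nadj => /g_s; exact: adj_y.
have c_cut : {within [set x | `|x| = 1], continuous (fun x => normalize (cut x))}%classic.
  apply: within_normalize => [i|x /g_skel[s [_ _ /cut_ex[i cut_i]]]]; last first.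
    by rewrite gt_eqF // (sum_pos (cut_ge0 x) cut_i).
  apply: (@within_ext _ _ _ (fun x => Num.max 0 (g x ord0 i - eps))) => [x _|].
    by rewrite mxE.
  apply/within_cvgP => x x1; apply: cvg_max0.
  by apply: cvgB; [exact: cgx|exact: cvg_cst].
have c_cone : {within [set x | `|x| = 1], continuous (fun x => normalize (cone x))}%classic.
  apply: within_normalize => [i|x /g_skel[s [sF les /(cone_ex _ _ sF les)[i cone_i]]]]; last first.
    by rewrite gt_eqF // (sum_pos (cone_ge0 x) cone_i).
  apply: (@within_ext _ _ _
    (fun x => if i \in D then Num.max 0 (eps - bad x i) else 0)) => [x _|].
    by rewrite mxE.
  apply/within_cvgP => x x1; case: ifP => _; last exact: cvg_cst.
  apply: cvg_max0; apply: cvgB; first exact: cvg_cst.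
  by apply: (cvg_big add_continuous) => v _; exact: cgx.
have face_p : in_face D (delta_mx ord0 p : 'rV[R]_n).
  split=> [i||i]; rewrite ?mxE ?eqxx /=.
  - by rewrite ler0n.
  - rewrite (bigD1 p) //= big1 ?addr0 ?mxE ?eqxx // => i /negbTE ip.
    by rewrite mxE eqxx /= ip.
  - by case: (eqVneq i p) => [->|]; rewrite ?eqxx.
apply: (extends_common_face (g := fun x => normalize (cut x)) cg) => [x x1|].
  have [s [sF les g_s]] := g_skel x x1; exists s; split => //.
  have [i cut_i] := cut_ex _ _ g_s; apply: in_face_normalize cut_i _ => // j.
  case: g_s => _ _ g_s; rewrite cut_pos => /(lt_trans eps_gt0) g_pos.
  by apply: g_s; rewrite gt_eqF.
apply: (extends_common_face (g := fun x => normalize (cone x)) c_cut) => [x x1|].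
  have [s [sF les g_s]] := g_skel x x1.
  have [i cut_i] := cut_ex _ _ g_s; have [y cone_y] := cone_ex _ _ sF les g_s.
  pose s1 := [set i | 0 < cut x ord0 i]; pose s2 := [set y | 0 < cone x ord0 y].
  have s1s u : u \in s1 -> u \in s.
    case: g_s => _ _ g_s; rewrite inE cut_pos => /(lt_trans eps_gt0) g_pos.
    by apply: g_s; rewrite gt_eqF.
  have s2D u : u \in s2 -> u \in D by rewrite inE cone_pos => /andP[].
  (* A vertex [u] of [s1] not adjacent to [v] would alone bring more than [eps] to [bad x v]. *)
  have s12 u v : u \in s1 -> v \in s2 -> adjacent F u v.
    rewrite !inE cut_pos cone_pos => g_u /andP[_]; apply: contraTT => nadj.
    rewrite -leNgt /bad (bigD1 u) //=; apply: le_trans (ltW g_u) _.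
    by rewrite lerDl sumr_ge0 // => ? _; case: g_s.
  exists (s1 :|: s2)%SET; split.
  (* Edges inside [s1] come from [s], those inside [s2] from [D], mixed ones from [s12]. *)
  - apply: flagF; first by apply/finset.set0Pn; exists i; rewrite !inE cut_i.
    move=> u v; rewrite !finset.in_setU => /orP[us|us] /orP[vs|vs] uv.
    + exact: (face_adjacent scF sF (s1s _ us) (s1s _ vs)).
    + exact: s12.
    + by rewrite adjacentC s12.
    + exact: (face_adjacent scF D_F (s2D _ us) (s2D _ vs)).
  - by apply: in_face_normalize cut_i _ => // j; rewrite !inE => ->.
  - by apply: in_face_normalize cone_y _ => // j; rewrite !inE => ->; rewrite orbT.
apply: (extends_common_face (g := fun=> delta_mx ord0 p) c_cone) => [x x1|].
  have [s [sF les g_s]] := g_skel x x1; have [y cone_y] := cone_ex _ _ sF les g_s.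
  exists D; split => //; apply: in_face_normalize cone_y _ => // j.
  by rewrite cone_pos => /andP[].
exists (fun=> delta_mx ord0 p); split=> [|x _|x _].
- by apply: continuous_subspaceT; exact: cst_continuous.
- by exists D; [exact: D_F|exact: face_p].
- by [].
Qed.

(** * Simplicial approximation on a fine grid *)

Section GridApproximation.
Variables (R : realType) (d : nat).
Implicit Types x y : 'rV[R]_d.

Lemma coord_le_norm x i : `|x ord0 i| <= `|x|.
Proof.
rewrite [leRHS]/Num.norm /= mx_normrE.
exact: (le_bigmax _ (fun ij => `|x ij.1 ij.2|) (ord0, i)).
Qed.

Lemma sphere_coord x : `|x| = 1 -> exists i, `|x ord0 i| = 1.
Proof.
move=> x1; have [|[j i] /= eq_i] := @mx_norm_neq0 R 1 d x.
  by rewrite -[mx_norm x]/`|x| x1 oner_neq0.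
by exists i; rewrite -[RHS]x1; move: eq_i; rewrite (ord1 j) => eq_i; exact: esym eq_i.
Qed.

Lemma norm_lt_coord x (e : R) :
  0 < e -> (forall i, `|x ord0 i| < e) -> `|x| < e.
Proof.
move=> e_gt0 x_lt; rewrite [ltLHS]/Num.norm /= mx_normrE.
by apply/bigmax_ltP; split => // -[i j] _ /=; rewrite ord1.
Qed.

(* Sends the cube [-1, 1]^d, which is the unit ball, to [0, 2N]^d. *)
Definition grid_coord (N : nat) x (i : 'I_d) : R := N%:R * (x ord0 i + 1).

Definition grid_weight N (z : {ffun 'I_d -> 'I_(N * 2).+1}) x : R :=
  kuhn_weight (grid_coord N x) (fun i => z i).

Lemma cvg_grid_weight (G : set_system 'rV[R]_d) N z x : Filter G ->
  (forall i, y ord0 i @[y --> G] --> x ord0 i)%classic ->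
  (@grid_weight N z y @[y --> G] --> grid_weight z x)%classic.
Proof.
move=> FG cG; have c_off q : (offset (grid_coord N y) (fun i => z i) q @[y --> G] -->
    offset (grid_coord N x) (fun i => z i) q)%classic.
  case: q => [i|] /=; last exact: cvg_cst.
  apply: cvgB; first exact: cvg_cst.
  apply: cvgM; first exact: cvg_cst.
  by apply: cvgD; [exact: cG|exact: cvg_cst].
rewrite /grid_weight /kuhn_weight.
apply: (@cvg_big R _ *%R 1 xpredT (@mul_continuous R)) => p _; apply: cvg_max0.
by apply: cvgB; [apply: cvgD; [exact: cvg_cst|exact: c_off]|exact: c_off].
Qed.

Lemma grid_weight_continuous N z : continuous (@grid_weight N z).
Proof.
move=> x; apply: (@cvg_grid_weight (nbhs x)) => i; exact: coord_continuous.
Qed.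

Lemma grid_weight_ge0 N z x : 0 <= @grid_weight N z x.
Proof. exact: kuhn_weight_ge0. Qed.

Lemma grid_coord_ge0 N x i : `|x| = 1 -> 0 <= grid_coord N x i.
Proof.
move=> x1; have := coord_le_norm x i; rewrite x1 ler_norml => /andP[x_ge _].
by rewrite mulr_ge0 // -lerBlDr sub0r.
Qed.

Lemma grid_weight_ex N x : `|x| = 1 -> exists z, 0 < @grid_weight N z x.
Proof.
move=> x1; have a_ge0 i := grid_coord_ge0 N i x1.
exists [ffun i => inord (Num.truncn (grid_coord N x i))].
rewrite /grid_weight.
rewrite (_ : (fun i => _) = (fun i => Num.truncn (grid_coord N x i))).
  exact: kuhn_weight_trunc.
apply/funext => i; rewrite ffunE inordK // ltnS truncn_le_nat.
have := coord_le_norm x i; rewrite x1 ler_norml => /andP[_ x_le].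
apply: (@le_lt_trans _ _ (N * 2)%:R); last by rewrite ltr_nat.
by rewrite natrM ler_wpM2l // -[2]/(1 + 1) lerD2r.
Qed.

(** The grid coordinates of both points are within 1 of [z], hence within 2 of each other, and the
    grid magnifies by [N]. *)
Lemma grid_weight_dist N z x y : (0 < N)%N ->
  0 < @grid_weight N z x -> 0 < grid_weight z y -> `|x - y| < 2 / N%:R.
Proof.
move=> N_gt0 wx wy; have NR_gt0 : 0 < N%:R :> R by rewrite ltr0n.
apply: norm_lt_coord => [|i]; first exact: divr_gt0.
rewrite !mxE ltr_pdivlMr // mulrC -[N%:R]gtr0_norm // -normrM.
have := kuhn_weight_near i wx; have := kuhn_weight_near i wy.
by rewrite /grid_coord !ltr_norml !mulrDr mulrN; lra.
Qed.

(** In the sup norm some coordinate is 1 or -1, so its grid coordinate [2N] or 0 is an integer. This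
    is what gives [d] rather than [d + 1]. *)
Lemma card_grid_weight_gt0 N x : `|x| = 1 ->
  (#|[set z : {ffun 'I_d -> 'I_(N * 2).+1} | (0 < grid_weight z x)%R]| <= d)%N.
Proof.
move=> x1; have [j xj] := sphere_coord x1.
have [c eq_c] : exists c : nat, grid_coord N x j = c%:R.
  rewrite /grid_coord; have [x_ge|x_lt] := leP 0 (x ord0 j).
    by exists (N * 2)%N; rewrite natrM -xj ger0_norm.
  by exists 0; rewrite -xj ltr0_norm // subrr mulr0.
apply: (card_kuhn_weight_gt0 _ eq_c) => [i|z]; first exact: grid_coord_ge0.
by rewrite inE.
Qed.
End GridApproximation.

(** Each grid vertex [z] is sent to a vertex [v z] at which [f] is positive on the whole part of the
    star of [z] in the sphere. Averaging with the grid weights keeps the support of [g x] inside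
    that of [f x]. *)
Lemma skeletal_approximation (R : realType) n d (F : {set {set 'I_n}})
    (f : 'rV[R]_d -> 'rV[R]_n) (i0 : 'I_n) :
  simplicial_complex F ->
  {within [set x | `|x| = 1], continuous f}%classic ->
  (forall x, `|x| = 1 -> geom F (f x)) ->
  exists2 g : 'rV[R]_d -> 'rV[R]_n,
    {within [set x | `|x| = 1], continuous g}%classic &
    forall x, `|x| = 1 -> exists s s', [/\ s \in F, s' \in F, s \subset s',
      in_face s' (f x) & in_face s (g x) /\ (#|s| <= d)%N].
Proof.
move=> [_ _ F_down] cf f_geom.
have [x x1|e e_gt0 near_f] := uniform_positive_coordinate (@compact_sphere R d) cf.
  by have [s _ /in_face_pos[i _ fi]] := f_geom x x1; exists i.
(* Fine enough that two points in one star are closer than [e]. *)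
pose N := (Num.truncn (2 / e)).+1.
have N_small : 2 / N%:R <= e.
  rewrite ler_pdivrMr ?ltr0n // mulrC -ler_pdivrMr //; exact/ltW/truncnS_gt.
have v_ex (z : {ffun 'I_d -> 'I_(N * 2).+1}) : exists i : 'I_n,
    forall y : 'rV[R]_d, `|y| = 1 -> 0 < grid_weight z y -> 0 < f y ord0 i.
  have [[x [x1 wx]]|no_x] := pselect (exists x : 'rV[R]_d, `|x| = 1 /\ 0 < grid_weight z x).
    have [i fi] := near_f x x1; exists i => y y1 wy; apply: fi => //.
    by apply: lt_le_trans N_small; exact: grid_weight_dist wx wy.
  (* A star missing the sphere gets the arbitrary vertex [i0]. *)
  by exists i0 => y y1 wy; case: no_x; exists y.
have [v v_f] := choice v_ex.
pose G x : 'rV[R]_n := \row_i \sum_(z | v z == i) grid_weight z x.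
have G_ge0 x i : 0 <= G x ord0 i.
  by rewrite mxE sumr_ge0 // => z _; exact: grid_weight_ge0.
have G_gt0 x z : 0 < grid_weight z x -> 0 < G x ord0 (v z).
  move=> wz; rewrite mxE (bigD1 z) //= ltr_pwDl // sumr_ge0 // => z' _.
  exact: grid_weight_ge0.
have G_pos x i : 0 < G x ord0 i -> exists2 z, v z = i & 0 < grid_weight z x.
  move=> Gi; apply: contrapT => no_z; move: Gi; rewrite mxE big1 ?ltxx // => z.
  move=> /eqP vz; apply/eqP; rewrite eq_le grid_weight_ge0 andbT leNgt.
  by apply/negP => wz; apply: no_z; exists z.
exists (fun x => normalize (G x)).
  apply: within_normalize => [i|x /grid_weight_ex-/(_ N)[z wz]]; last first.
    by rewrite gt_eqF // (sum_pos (G_ge0 x) (G_gt0 x z wz)).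
  apply: (@within_ext _ _ _ (fun x => \sum_(z | v z == i) grid_weight z x)) => [x _|].
    by rewrite mxE.
  apply: continuous_subspaceT; apply: (continuous_big add_continuous) => z _.
  exact: grid_weight_continuous.
move=> x x1; have [s' s'F f_s'] := f_geom x x1; have [z wz] := grid_weight_ex N x1.
pose Z := [set z : {ffun 'I_d -> 'I_(N * 2).+1} | 0 < grid_weight z x].
have sub_s' : [set v z | z in Z]%SET \subset s'.
  apply/fintype.subsetP => _ /imsetP[z' + ->]; rewrite inE => /(v_f _ _ x1) fv.
  by case: f_s' => _ _; apply; rewrite gt_eqF.
exists [set v z | z in Z]%SET, s'; split => //.
  apply: (F_down s') => //; apply/finset.set0Pn; exists (v z).
  by apply: imset_f; rewrite inE.
split; last by rewrite (leq_trans (leq_imset_card _ _)) // card_grid_weight_gt0.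
apply: in_face_normalize (G_gt0 x z wz) _ => // j /G_pos[z' <- wz'].
by apply: imset_f; rewrite inE.
Qed.

(** * From closed faces back to the realization, and the connectivity bound *)

Lemma realization_geom n (F : {set {set 'I_n}}) t :
  simplicial_complex F -> realization F t <-> geom F t.
Proof.
move=> [_ _ F_down]; split=> [[t_ge0 [t_sum tF]]|[s sF t_s]].
  by exists [set i | t ord0 i != 0] => //; split=> // i; rewrite inE.
have [t_ge0 t_sum t_sub] := t_s.
split=> //; split=> //; apply: (F_down s) => //.
  by apply/fintype.subsetP => i; rewrite inE; exact: t_sub.
have [i _ ti] := in_face_pos t_s.
by apply/finset.set0Pn; exists i; rewrite inE gt_eqF.
Qed.

Theorem theorem4p9 (m k n : nat) (F : {set {set 'I_n}}) :
  (1 <= m)%N -> (1 <= k)%N ->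
  simplicial_complex F -> flag_complex F -> grounded F (m * k) k ->
  c_connected (m%:Z - 1)%R (realization F).
Proof.
move=> _ _ scF flagF [D [cardD groundD]] d le_d f cf f_real.
(* The approximation has faces of at most [d] vertices, and [d <= m] is what the search for common
   neighbours requires. *)
have {}le_d : (d <= m)%N by move: le_d; rewrite subrK lez_nat.
have ltD : (m * k < #|D|)%N by rewrite cardD.
have [p _] : exists p, p \in D by apply/card_gt0P; exact: leq_ltn_trans ltD.
have f_geom x : `|x| = 1 -> geom F (f x).
  by move=> x1; apply/realization_geom => //; exact: f_real.
have [g cg g_skel] := skeletal_approximation p scF cf f_geom.
have ext_g : extends_to_ball (geom F) g.
  apply: (skeletal_extends scF flagF groundD ltD cg) => x /g_skel[s [_ [sF _ _ _ []]]].
  by move=> g_s le_s; exists s; split => //; exact: leq_trans le_d.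
have [x x1|h [ch h_geom hf]] := extends_common_face cf _ ext_g.
  have [s [s' [_ s'F ss' f_s' [g_s _]]]] := g_skel x x1.
  (* The small face [s] lies in [s'], which therefore carries both [f x] and [g x]. *)
  by exists s'; split=> //; exact: in_faceS g_s.
exists h; split=> // x x1; apply/realization_geom => //; exact: h_geom.
Qed.
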